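(* Let $N,n\ge 1$, and let a network of $N$ cells be given in which each cell $i\in\{1,\dots,N\}$ has a neighbourhood $\mathcal{N}_i\subseteq\{1,\dots,N\}$ of size $n$ (listed in a fixed order). Let $f:\{0,1\}^n\to\{0,1\}$ be a CA rule. Let transmission times $\tau_{ij}\in\mathbb{R}$ ($j\in\mathcal{N}_i$), processing times $\xi_i\in\mathbb{R}$ and an initial time vector $\mathbf{x}(0)\in\mathbb{R}^N$ be given, and let $\mathbf{s}(0)\in\{0,1\}^N$ be an initial CA state. Let $\mathbf{s}_{\mathcal{S}}(k)$ denote the CA state after $k$ iterations of the synchronous system started from $\mathbf{s}(0)$, and let $\mathbf{s}_{\mathcal{M}}(k)$ denote the CA state on the $k$-th contour (that is, after $k$ updates of every cell) of the max-plus system started from $\mathbf{s}(0)$ and $\mathbf{x}(0)$, with the same network and the same rule $f$. Then $$\mathbf{s}_{\mathcal{S}}(k)=\mathbf{s}_{\mathcal{M}}(k)\qquad\text{for all integers } k\ge 0.$$ Consequently, $\mathbf{s}_{\mathcal{S}}(k)\mapsto \mathbf{s}_{\mathcal{M}}(k)$ defines a bijection between the orbit $\mathcal{S}$ of $\mathbf{s}(0)$ generated by the synchronous system and the orbit $\mathcal{M}$ of $\mathbf{s}(0)$ generated by the max-plus system, and the two systems have the same state transition graph (for the max-plus system, transitions are taken between CA states on consecutive contours).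
   Context: Synchronous system: all cells update simultaneously at times $t=0,1,2,\dots$. The state of cell $i$ at time $k+1$ is $f$ applied to the states at time $k$ of the cells in $\mathcal{N}_i$ (in the fixed order). Max-plus (asynchronous) system: cell $i$ performs its $k$-th update at real time $x_i(k)$. After its $k$-th update, each cell $j$ sends its new state to every cell $i$ with $j\in\mathcal{N}_i$, and this transmission takes time $\tau_{ij}$. Cell $i$ waits until the $k$-th states of all cells in $\mathcal{N}_i$ have arrived, and then takes processing time $\xi_i$ to compute its new state by applying $f$ to these received states. Thus the update times satisfy $$x_i(k+1)=\max_{j\in\mathcal{N}_i}\{x_j(k)+\tau_{ij}\}+\xi_i ,$$ and the CA state $s_i(k)$ of cell $i$ at time $x_i(k)$ satisfies $$s_i(k)=f\big(s_{\mathcal{N}_i}(k-1)\big),\qquad k\ge 1,$$ where $s_{\mathcal{N}_i}(k-1)$ is the tuple of states $s_j(k-1)$, $j\in\mathcal{N}_i$, in the fixed order. The initial state $s_i(0)$ is given at time $x_i(0)$. The $k$-th contour is the vector $\mathbf{x}(k)=(x_1(k),\dots,x_N(k))$, and the CA state on the $k$-th contour is $\mathbf{s}(k)=(s_1(k),\dots,s_N(k))$, where $s_i(k)$ is the state of cell $i$ at time $x_i(k)$. The orbit of $\mathbf{s}(0)$ is the sequence (or the set) of CA states $\mathbf{s}(0),\mathbf{s}(1),\mathbf{s}(2),\dots$. The state transition graph is the digraph on vertex set $\{0,1\}^N$ with an arc from $\mathbf{s}$ to $\mathbf{s}'$ if and only if one iteration of the system takes CA state $\mathbf{s}$ to CA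 state $\mathbf{s}'$. *)

(* Defs.v *)
From HB Require Import structures.
From mathcomp Require Import all_boot all_order all_algebra.
From mathcomp Require Import boolp classical_sets functions reals.

Set Implicit Arguments.
Unset Strict Implicit.
Unset Printing Implicit Defensive.

Import Order.TTheory GRing.Theory Num.Theory.
Local Open Scope ring_scope.

(* Each cell has exactly [n] distinct neighbours, listed in a fixed order. *)
Record network (N n : nat) := Network {
  nbr :> 'I_N -> n.-tuple 'I_N;
  nbr_uniq : forall i, uniq (nbr i)
}.

Definition ca_state (N : nat) := {ffun 'I_N -> bool}.

Definition ca_rule (n : nat) := n.-tuple bool -> bool.

Section Synchronous.
Variables (N n : nat) (net : network N n) (f : ca_rule n).

Definition sync_step (s : ca_state N) : ca_state N :=
  [ffun i => f (map_tuple s (net i))].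

Definition sync_state (s0 : ca_state N) (k : nat) : ca_state N :=
  iter k sync_step s0.

Definition sync_graph : set (ca_state N * ca_state N) :=
  [set a | sync_step a.1 = a.2]%classic.

End Synchronous.

Section MaxPlus.
Variables (R : realType) (N n : nat) (net : network N n) (f : ca_rule n).
(* [tau i j] is the transmission time from [j] to [i]; only the values at the
   neighbours [j] of [i] are ever used. *)
Variables (tau : 'I_N -> 'I_N -> R) (xi : 'I_N -> R).

(* The [k]-th contour: the times of the [k]-th updates of the cells, together
   with the states the cells take at these updates. *)
Record contour := Contour {
  times : {ffun 'I_N -> R};
  states : ca_state N
}.

(* A transmitted state, together with its time of arrival. *)
Record message := Message { arrival : R; payload : bool }.

Definition inbox (c : contour) (i : 'I_N) : n.-tuple message :=
  map_tuple (fun j => Message (times c j + tau i j) (states c j)) (net i).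

(* The maximum of a nonempty sequence of reals: the first item serves as the
   initial value of the iteration, so the default [0] only matters for [::]. *)
Definition max_seq (r : seq R) : R := \big[Num.max/head 0 r]_(t <- r) t.

Definition update_time (ms : n.-tuple message) (i : 'I_N) : R :=
  max_seq (map arrival ms) + xi i.

Definition update_state (ms : n.-tuple message) : bool :=
  f (map_tuple payload ms).

Definition maxplus_step (c : contour) : contour :=
  Contour [ffun i => update_time (inbox c i) i]
          [ffun i => update_state (inbox c i)].

Definition maxplus_contour (x0 : {ffun 'I_N -> R}) (s0 : ca_state N)
    (k : nat) : contour :=
  iter k maxplus_step (Contour x0 s0).

Definition maxplus_state (x0 : {ffun 'I_N -> R}) (s0 : ca_state N)
    (k : nat) : ca_state N :=
  states (maxplus_contour x0 s0 k).

(* Arcs join the CA states on consecutive contours, over all runs with initial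
   time vector [x0] (the initial CA state is free, every CA state being a
   vertex). *)
Definition maxplus_graph (x0 : {ffun 'I_N -> R}) :
    set (ca_state N * ca_state N) :=
  [set a | exists s0 k, maxplus_state x0 s0 k = a.1 /\
                        maxplus_state x0 s0 k.+1 = a.2]%classic.

End MaxPlus.

Definition orbit_of (N : nat) (s : nat -> ca_state N) : set (ca_state N) :=
  range s.

(* Main.v *)
(** The clock data only decide when a cell updates, never which states it
    reads: the inbox of cell [i] at its [k]-th update carries exactly the
    [k]-th states of its neighbours.  Hence forgetting the times maps the
    max-plus dynamics onto the synchronous one, for arbitrary times. *)

Require Import Defs.
From HB Require Import structures.
From mathcomp Require Import all_boot all_order all_algebra.
From mathcomp Require Import boolp classical_sets functions reals.

Lemma payload_inbox (R : realType) (N n : nat) (net : network N n)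
    (tau : 'I_N -> 'I_N -> R) (c : contour R N) (i : 'I_N) :
  map_tuple (@payload R) (inbox net tau c i) = map_tuple (states c) (net i).
(* On underlying sequences the two maps fuse, and [payload] of the message sent by [j] reduces to
   [states c j]. *)
Proof. by apply: val_inj; rewrite /= -map_comp. Qed.

Lemma states_maxplus_step (R : realType) (N n : nat) (net : network N n)
    (f : ca_rule n) (tau : 'I_N -> 'I_N -> R) (xi : 'I_N -> R)
    (c : contour R N) :
  states (maxplus_step net f tau xi c) = sync_step net f (states c).
Proof. by apply/ffunP => i; rewrite !ffunE /update_state payload_inbox. Qed.

Lemma maxplus_stateE (R : realType) (N n : nat) (net : network N n)
    (f : ca_rule n) (tau : 'I_N -> 'I_N -> R) (xi : 'I_N -> R)
    (x0 : {ffun 'I_N -> R}) (s0 : ca_state N) :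
  maxplus_state net f tau xi x0 s0 =1 sync_state net f s0.
Proof.
elim=> [//|k IHk].
(* Once the induction hypothesis is folded in, both sides speak of the [k]-th contour, and one step
   commutes with [states]. *)
by rewrite /sync_state iterS -/(sync_state _ _ _ _) -IHk; exact: states_maxplus_step.
Qed.

(** Transitions between later contours are synchronous steps too, so they add no arcs to those
    leaving contour 0. *)
Lemma maxplus_graphE (R : realType) (N n : nat) (net : network N n)
    (f : ca_rule n) (tau : 'I_N -> 'I_N -> R) (xi : 'I_N -> R)
    (x0 : {ffun 'I_N -> R}) :
  maxplus_graph net f tau xi x0 = sync_graph net f.
Proof.
apply/seteqP; split=> -[s s'] /=.
  by move=> [s0 [k]]; rewrite !maxplus_stateE /= => -[<- <-].
(* The tail of the arc serves as initial state. *)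
by move=> ss'; exists s, 0%N; rewrite !maxplus_stateE.
Qed.

Theorem mainTheorem1 (R : realType) (N n : nat) (hN : (1 <= N)%N) (hn : (1 <= n)%N)
    (net : network N n) (f : ca_rule n)
    (tau : 'I_N -> 'I_N -> R) (xi : 'I_N -> R)
    (x0 : {ffun 'I_N -> R}) (s0 : ca_state N) :
  let sS := sync_state net f s0 in
  let sM := maxplus_state net f tau xi x0 s0 in
  [/\ (forall k : nat, sS k = sM k),
      (exists phi : ca_state N -> ca_state N,
         (forall k : nat, phi (sS k) = sM k) /\
         set_bij (orbit_of sS) (orbit_of sM) phi)
    & sync_graph net f = maxplus_graph net f tau xi x0].
Proof.
move=> sS sM.
have sSM : sS = sM by apply/funext => k; rewrite /sM maxplus_stateE.
split; [by rewrite sSM | | by rewrite maxplus_graphE].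
(* The two sequences are equal, so the orbits are the same set and the identity is the required
   bijection. *)
exists id; rewrite -sSM; split=> //.
by split=> [s|s s' _ _|s orb_s] //; exists s.
Qed.
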